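(* Let $\mu=\{B_{-m},\dots,B_n\}$ be a bucket list, $\gamma\in(0,1)$ a fee rate, $T\ge 1$ a time horizon, $\mathcal{P}$ a belief profile (a probability distribution over contract-market price sequences $\mathbf{P}=(P_0,\dots,P_T)$), and $a\ge 0$ a risk-aversion parameter. Then the expected risk-averse profit and loss $$\mathit{PnL}^a_{\mathcal{P}}(\boldsymbol{\ell})=\mathbb{E}_{\mathbf{P}\sim\mathcal{P}}\left[u_a\big(\mathit{PnL}(\boldsymbol{\ell},\mathbf{P})\big)\right]$$ is a concave function of the liquidity allocation $\boldsymbol{\ell}\in\mathbb{R}_{\ge 0}^{m+n+1}$.
   Context: Prices are positive reals. A bucket list $\mu=\{B_{-m},\dots,B_n\}$ partitions $(0,\infty)$ into consecutive intervals: $B_{-m}=(0,b_{-m}]$, $B_i=[a_i,b_i]$ for $-m<i<n$, $B_n=[a_n,\infty)$, with $a_i<b_i$ and $b_i=a_{i+1}$ for $i<n$. Put $a_{-m}=0$, $b_n=\infty$, with conventions $\sqrt{0}=0$ and $1/\sqrt{\infty}=0$. A liquidity allocation is $\boldsymbol{\ell}=(\ell_{-m},\dots,\ell_n)$ with all $\ell_i\ge 0$. Notation: $\Delta^x_{P,P'}=\frac1{\sqrt{P'}}-\frac1{\sqrt P}$ and $\Delta^y_{P,P'}=\sqrt{P'}-\sqrt P$. The bundle value of $L$ units of $[a,b]$-liquidity at price $P$ is $$\mathcal{V}^{(3)}(L,a,b,P)=\begin{cases}(L\Delta^x_{b,a},0)&P<a\\(0,L\Delta^y_{a,b})&P>b\\(L\Delta^x_{b,P},L\Delta^y_{a,P})&P\in[a,b].\end{cases}$$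 The market worth in token $B$ of a bundle $(x,y)$ at market price $p$ is $\mathcal{B}((x,y),p)=p\,x+y$. A contract-market price sequence is $\mathbf{P}=(P_0,\dots,P_T)$ with $P_t=(P_{c,t},P_{m,t})\in(0,\infty)^2$ (contract price, market price). Trading fees: each contract price movement is split into sub-movements each lying within a single bucket. A sub-movement from $p$ to $p'$ inside bucket $B_i$ yields $\ell_i\frac{\gamma}{1-\gamma}\Delta^y_{p,p'}$ units of token $B$ if $p'>p$, yields $\ell_i\frac{\gamma}{1-\gamma}\Delta^x_{p,p'}$ units of token $A$ if $p'<p$, and yields nothing if $p'=p$. Let $F^A(\boldsymbol{\ell},\mathbf{P})$ and $F^B(\boldsymbol{\ell},\mathbf{P})$ be the total token $A$ and token $B$ fees over the sequence, and $F(\boldsymbol{\ell},\mathbf{P})=P_{m,T}F^A(\boldsymbol{\ell},\mathbf{P})+F^B(\boldsymbol{\ell},\mathbf{P})$. Impermanent loss between $P=(P_c,P_m)$ and $P'=(P_c',P_m')$: $$\mathit{IL}(\boldsymbol{\ell},P,P')=\sum_{i=-m}^n\Big[\mathcal{B}(\mathcal{V}^{(3)}(\ell_i,a_i,b_i,P_c),P_m')-\mathcal{B}(\mathcal{V}^{(3)}(\ell_i,a_i,b_i,P_c'),P_m')\Big].$$ Profit and loss: $\mathit{PnL}(\boldsymbol{\ell},\mathbf{P})=F(\boldsymbol{\ell},\mathbf{P})-\mathit{IL}(\boldsymbol{\ell},P_0,P_T)$. Exponential utility: $u_a(x)=(1-e^{-ax})/a$ if $a\ne 0$, and $u_0(x)=x$.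 The expectation defining $\mathit{PnL}^a_{\mathcal{P}}(\boldsymbol{\ell})$ is assumed to exist and be finite for every $\boldsymbol{\ell}\in\mathbb{R}_{\ge0}^{m+n+1}$. *)

(* Defs.v *)
From HB Require Import structures.
From mathcomp Require Import all_boot all_order all_algebra.
From mathcomp Require Import all_classical all_reals all_analysis.

Set Implicit Arguments.
Unset Strict Implicit.
Unset Printing Implicit Defensive.

Import Order.TTheory GRing.Theory Num.Theory.
Import numFieldNormedType.Exports.

Local Open Scope classical_set_scope.
Local Open Scope ring_scope.

(* The buckets B_{-m}, ..., B_n are indexed by
   'I_(m + n).+1: the ordinal k stands for the bucket B_{k-m}.  Only the
   outermost endpoints 0 and +oo are imposed; that the others are finite and
   positive follows from lo_lt_hi and hi_lo. *)
Record bucket_list (R : realType) (m n : nat) := BucketList {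
  lo : 'I_(m + n).+1 -> \bar R ;
  hi : 'I_(m + n).+1 -> \bar R ;
  lo_first : lo ord0 = 0%E ;
  hi_last : hi ord_max = +oo%E ;
  lo_lt_hi : forall i, (lo i < hi i)%E ;
  hi_lo : forall i j : 'I_(m + n).+1, j = i.+1 :> nat -> hi i = lo j }.

Section definitions.
Context {R : realType}.

(* Never evaluated at -oo.  The value at +oo is never used: sqrt b only occurs
   in the value of a position when the price is above b. *)
Definition sqrte (P : \bar R) : R :=
  match P with r%:E => Num.sqrt r | _ => 0 end.

(* The convention 1 / sqrt +oo = 0.  The value at 0 is never used: 1 / sqrt a
   only occurs in the value of a position when the price is below a. *)
Definition inv_sqrte (P : \bar R) : R :=
  match P with r%:E => (Num.sqrt r)^-1 | _ => 0 end.

Definition delta_x (P P' : \bar R) : R := inv_sqrte P' - inv_sqrte P.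

Definition delta_y (P P' : \bar R) : R := sqrte P' - sqrte P.

Definition bundle_value (L : R) (a b : \bar R) (P : R) : R * R :=
  if (P%:E < a)%E then (L * delta_x b a, 0)
  else if (b < P%:E)%E then (0, L * delta_y a b)
  else (L * delta_x b P%:E, L * delta_y a P%:E).

Definition market_worth (xy : R * R) (p : R) : R := p * xy.1 + xy.2.

Definition exp_utility (a x : R) : R :=
  if a == 0 then x else (1 - expR (- a * x)) / a.

Definition concave_function (E : lmodType R) (D : set (convex_lmodType E))
    (f : convex_lmodType E -> R^o) : Prop :=
  convex_function D (fun x => - f x).

Definition allocations (N : nat) : set 'rV[R]_N :=
  [set l | forall i, 0 <= l 0 i].

(* A tuple s encodes P_0, ..., P_T with P_t = (P_{c,t}, P_{m,t}); its sigma-algebra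
   is the product of the Borel ones. *)
Definition positive_seqs (T : nat) : set (T.+1.-tuple (R * R)) :=
  [set s | forall t, 0 < (tnth s t).1 /\ 0 < (tnth s t).2].

Section buckets.
Context {m n : nat} (mu : bucket_list R m n).
Local Notation N := (m + n).+1.
Implicit Types (l : 'rV[R]_N) (gamma : R).

Definition in_bucket (i : 'I_N) (p : R) : bool :=
  (0 < p) && (lo mu i <= p%:E <= hi mu i)%E.

(* The bucket boundaries strictly between p and p', in increasing order. *)
Definition crossings (p p' : R) : seq R :=
  [seq fine (hi mu i) | i <- enum 'I_N & (p%:E < hi mu i < p'%:E)%E].

(* A contract price movement from p to p' is cut at the bucket boundaries it
   crosses; its sub-movements are the pairs of consecutive prices. *)
Definition sub_movements (p p' : R) : seq (R * R) :=
  let s := rcons (if p <= p' then crossings p p' else rev (crossings p' p)) p'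
  in zip (p :: s) s.

(* A non-constant sub-movement lies in exactly one bucket, so the sums below
   have at most one term. *)
Definition sub_fee_A gamma l (p p' : R) : R :=
  if p' < p then
    \sum_(i | in_bucket i p && in_bucket i p')
       l 0 i * (gamma / (1 - gamma)) * delta_x p%:E p'%:E
  else 0.

Definition sub_fee_B gamma l (p p' : R) : R :=
  if p < p' then
    \sum_(i | in_bucket i p && in_bucket i p')
       l 0 i * (gamma / (1 - gamma)) * delta_y p%:E p'%:E
  else 0.

Definition IL l (P P' : R * R) : R :=
  \sum_(i < N)
    (market_worth (bundle_value (l 0 i) (lo mu i) (hi mu i) P.1) P'.2
     - market_worth (bundle_value (l 0 i) (lo mu i) (hi mu i) P'.1) P'.2).

Section sequences.
Context {T : nat}.
Implicit Type s : T.+1.-tuple (R * R).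

Definition contract_moves s : seq (R * R) :=
  flatten [seq sub_movements (tnth s (widen_ord (leqnSn T) t)).1
                             (tnth s (lift ord0 t)).1 | t <- enum 'I_T].

Definition fees_A gamma l s : R :=
  \sum_(d <- contract_moves s) sub_fee_A gamma l d.1 d.2.

Definition fees_B gamma l s : R :=
  \sum_(d <- contract_moves s) sub_fee_B gamma l d.1 d.2.

Definition fees gamma l s : R :=
  (tnth s ord_max).2 * fees_A gamma l s + fees_B gamma l s.

Definition PnL gamma l s : R :=
  fees gamma l s - IL l (tnth s ord0) (tnth s ord_max).

Definition expected_PnL (P : probability (T.+1.-tuple (R * R)) R)
    gamma (a : R) l : R :=
  fine 'E_P[fun s => exp_utility a (PnL gamma l s)].

End sequences.
End buckets.
End definitions.

Arguments allocations : clear implicits.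
Arguments positive_seqs : clear implicits.

(* Main.v *)
Require Import Defs.
From HB Require Import structures.
From mathcomp Require Import all_boot all_order all_algebra.
From mathcomp Require Import all_classical all_reals all_analysis.
From mathcomp Require Import ring.

Set Implicit Arguments.
Unset Strict Implicit.
Unset Printing Implicit Defensive.

Import Order.TTheory GRing.Theory Num.Theory.
Import numFieldNormedType.Exports.

(* PnL is linear in the allocation, for every price sequence, and the
   exponential utility is concave, so the utility of the PnL is concave in the
   allocation for every price sequence; expectation preserves this. *)

Local Open Scope classical_set_scope.
Local Open Scope ring_scope.

(** The case distinction compares only [P] with [a] and [b], so all three bundles fall in the same
    branch, and each branch is linear in the liquidity. *)
Lemma market_worth_bundle_value_linear (R : realType) (c d L L' : R)
    (a b : \bar R) (P p : R) :
  market_worth (bundle_value (c * L + d * L') a b P) p =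
  c * market_worth (bundle_value L a b P) p +
  d * market_worth (bundle_value L' a b P) p.
Proof.
by rewrite /bundle_value /market_worth; case: ifP => _ /=;
  [|case: ifP => _ /=]; ring.
Qed.

(** For [a > 0] the utility is a decreasing affine function of the convex [expR (- a * x)]; for
    [a = 0] it is the identity. *)
Lemma exp_utility_concave (R : realType) (a : R) (t : {i01 R}) (x y : R^o) :
  0 <= a ->
  t%:num * exp_utility a x + (1 - t%:num) * exp_utility a y
  <= exp_utility a (t%:num * x + (1 - t%:num) * y).
Proof.
rewrite /exp_utility le_eqVlt eq_sym => /orP[/eqP ->|a_gt0].
  by rewrite eqxx.
rewrite gt_eqF // !mulrA -mulrDl ler_pM2r ?invr_gt0 //.
(* The weights sum to 1, so the constant terms cancel and only the convexity of [expR] between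
   [- a * x] and [- a * y] remains. *)
rewrite !mulrBr !mulr1 addrACA (addrC t%:num) subrK -opprD lerB //.
have := convex_expR t (- a * x : R^o) (- a * y : R^o).
by rewrite !convRE mulrDr !(mulrCA (- a)).
Qed.

Section PnL_linear.
Context {R : realType} {m n : nat} (mu : bucket_list R m n) (gamma : R).
Local Notation alloc := 'rV[R]_(m + n).+1.
Implicit Types (c d : R) (k l : alloc).

(** The direction of the move and the bucket containing it depend on prices alone; the allocation
    enters only as a factor of each term. *)
Lemma sub_fee_A_linear c d k l (p p' : R) :
  sub_fee_A mu gamma (c *: k + d *: l) p p' =
  c * sub_fee_A mu gamma k p p' + d * sub_fee_A mu gamma l p p'.
Proof.
rewrite /sub_fee_A; case: ifP => _; last by rewrite !mulr0 addr0.
rewrite !mulr_sumr -big_split; apply: eq_bigr => i _.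
by rewrite !mxE /=; ring.
Qed.

Lemma sub_fee_B_linear c d k l (p p' : R) :
  sub_fee_B mu gamma (c *: k + d *: l) p p' =
  c * sub_fee_B mu gamma k p p' + d * sub_fee_B mu gamma l p p'.
Proof.
rewrite /sub_fee_B; case: ifP => _; last by rewrite !mulr0 addr0.
rewrite !mulr_sumr -big_split; apply: eq_bigr => i _.
by rewrite !mxE /=; ring.
Qed.

Lemma IL_linear c d k l (P P' : R * R) :
  IL mu (c *: k + d *: l) P P' = c * IL mu k P P' + d * IL mu l P P'.
Proof.
rewrite /IL !mulr_sumr -big_split; apply: eq_bigr => i _.
by rewrite !mxE !market_worth_bundle_value_linear /=; ring.
Qed.

(** The list of sub-movements is the same for every allocation, so linearity passes through the
    sums. *)
Lemma fees_linear T c d k l (s : T.+1.-tuple (R * R)) :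
  fees mu gamma (c *: k + d *: l) s =
  c * fees mu gamma k s + d * fees mu gamma l s.
Proof.
rewrite /fees /fees_A /fees_B.
under eq_bigr do rewrite sub_fee_A_linear.
under [X in _ + X = _]eq_bigr do rewrite sub_fee_B_linear.
by rewrite !big_split /= -!mulr_sumr; ring.
Qed.

Lemma PnL_linear T c d k l (s : T.+1.-tuple (R * R)) :
  PnL mu gamma (c *: k + d *: l) s =
  c * PnL mu gamma k s + d * PnL mu gamma l s.
Proof. by rewrite /PnL fees_linear IL_linear; ring. Qed.

End PnL_linear.

Theorem lemma1 (R : realType) (m n : nat) (mu : bucket_list R m n)
    (gamma : R) (gamma_gt0 : 0 < gamma) (gamma_lt1 : gamma < 1)
    (T : nat) (T_ge1 : (1 <= T)%N)
    (P : probability (T.+1.-tuple (R * R)) R)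
    (P_positive : P (positive_seqs R T) = 1%E)
    (a : R) (a_ge0 : 0 <= a)
    (expectation_finite : forall l : 'rV[R]_(m + n).+1,
        allocations R (m + n).+1 l ->
        P.-integrable [set: T.+1.-tuple (R * R)]
          (fun s => (exp_utility a (PnL mu gamma l s))%:E)) :
  concave_function (allocations R (m + n).+1) (expected_PnL mu P gamma a).
Proof.
move=> t k l /set_mem Dk /set_mem Dl.
pose E (l : 'rV[R]_(m + n).+1) :=
  (\int[P]_(s in setT) exp_utility a (PnL mu gamma l s))%R.
(* Unlocking the expectation gives a real-valued integral, to which linearity and monotonicity
   apply. *)
have -> : expected_PnL mu P gamma a = E.
  by apply/funext => h; rewrite /expected_PnL unlock.
(* Integrability is assumed only for nonnegative allocations, so the convex combination must be
   one. *)
have Dkl : allocations R (m + n).+1 (t%:num *: k + (1 - t%:num) *: l).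
  by move=> i; rewrite !mxE addr_ge0 // mulr_ge0 ?subr_ge0.
have intZ c h : allocations R (m + n).+1 h -> P.-integrable setT
    (EFin \o (fun s => c * exp_utility a (PnL mu gamma h s))).
  by move=> Dh; exact: (integrableZl measurableT c (expectation_finite _ Dh)).
rewrite -[leRHS]convN lerN2 convRE /E.
rewrite -!RintegralZl; [|by []|exact: (expectation_finite _ Dl)
  |by []|exact: (expectation_finite _ Dk)].
rewrite -RintegralD; [|by []|exact: intZ..].
(* Both sides are now single integrals, so a comparison for each price sequence suffices. *)
apply: le_Rintegral => //.
- exact: integrableD (intZ _ _ Dk) (intZ _ _ Dl).
- exact: expectation_finite.
move=> s _ /=; apply: le_trans (exp_utility_concave _ _ _ a_ge0) _.
by rewrite -PnL_linear.
Qed.
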